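(* For the Gaussian MAC-IC-MAC there is no more than a one-bit gap between $\mathcal{R}_{\mathrm{c}}^{\mathrm{G}}$ and $\mathcal{R}_{\mathrm{o}}^{\mathrm{G}}$: if $(R_{\varTheta_1},R_{\varTheta_2})\in\mathcal{R}_{\mathrm{o}}^{\mathrm{G}}$ and $R_{i.j}\ge1$ for all $i.j$, then the tuple obtained by subtracting $1$ from every coordinate lies in $\mathcal{R}_{\mathrm{c}}^{\mathrm{G}}$.
   Context: **Indices.** $K_1,K_2\ge 1$ are integers. For $i\in\{1,2\}$, $i'$ denotes the other element of $\{1,2\}$, and $\varTheta_i=\{i.1,\dots,i.K_i\}$. $\varUpsilon_i$ always denotes a subset of $\varTheta_i$ containing $i.1$; $\varOmega_i$ always denotes a non-empty subset of $\varTheta_i$. For $S\subseteq\varTheta_i$, $R(S)=\sum_{i.j\in S}R_{i.j}$. Logarithms are base 2 (rates in bits). **Parameters.** The Gaussian MAC-IC-MAC has complex inputs $X_{i.j}$ with average power constraints $P_{i.j}$ and outputs $Y_i=\sum_{j=1}^{K_i}h_{i.j\to i}X_{i.j}+h_{i'.1\to i}X_{i'.1}+Z_i$, $Z_i\sim\mathcal{CN}(0,1)$, $i=1,2$. Set $\mathsf{SNR}_{i.j\to i}=P_{i.j}|h_{i.j\to i}|^2\ge 0$ and $\mathsf{INR}_{i'.1\to i}=P_{i'.1}|h_{i'.1\to i}|^2\ge0$. **Generic region.** For set functions $\mathcal{A}_{\varUpsilon_i},\mathcal{B}_{\varOmega_i},\mathcal{E}_{\varUpsilon_i},\mathcal{G}_{\varOmega_i}$,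 let $\mathcal{R}_{\mathrm{c}}(\mathcal{A},\mathcal{B},\mathcal{E},\mathcal{G})$ be the set of $(R_{\varTheta_1},R_{\varTheta_2})\in\mathbb{R}_+^{K_1+K_2}$ such that for all admissible $\varUpsilon_1,\varOmega_1,\varUpsilon_2,\varOmega_2$: 1. $R(\varOmega_1)\le\mathcal{B}_{\varOmega_1}$ 2. $R(\varOmega_2)\le\mathcal{B}_{\varOmega_2}$ 3. $R(\varUpsilon_1)+R(\varOmega_2)\le\mathcal{A}_{\varUpsilon_1}+\mathcal{G}_{\varOmega_2}$ 4. $R(\varOmega_1)+R(\varUpsilon_2)\le\mathcal{G}_{\varOmega_1}+\mathcal{A}_{\varUpsilon_2}$ 5. $R(\varUpsilon_1)+R(\varUpsilon_2)\le\mathcal{E}_{\varUpsilon_1}+\mathcal{E}_{\varUpsilon_2}$ 6. $R(\varUpsilon_1)+R(\varOmega_1)+R(\varUpsilon_2)\le\mathcal{A}_{\varUpsilon_1}+\mathcal{G}_{\varOmega_1}+\mathcal{E}_{\varUpsilon_2}$ 7. $R(\varUpsilon_1)+R(\varUpsilon_2)+R(\varOmega_2)\le\mathcal{E}_{\varUpsilon_1}+\mathcal{A}_{\varUpsilon_2}+\mathcal{G}_{\varOmega_2}$. **The region $\mathcal{R}_{\mathrm{c}}^{\mathrm{G}}=\mathcal{R}_{\mathrm{c}}(A,B,E,G)$.** With $\mathsf{C}(P)=\log(1+P)$ and $\mu_i=\min\{1,1/\mathsf{INR}_{i.1\to i'}\}$, $$A_{\varUpsilon_i}=\mathsf{C}\left(\frac{\mu_i\mathsf{SNR}_{i.1\to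 i}+\sum_{i.j\in\varUpsilon_i\setminus\{i.1\}}\mathsf{SNR}_{i.j\to i}}{1+\mu_{i'}\mathsf{INR}_{i'.1\to i}}\right),\qquad B_{\varOmega_i}=\mathsf{C}\left(\frac{\sum_{i.j\in\varOmega_i}\mathsf{SNR}_{i.j\to i}}{1+\mu_{i'}\mathsf{INR}_{i'.1\to i}}\right),$$ $$E_{\varUpsilon_i}=\mathsf{C}\left(\frac{\mu_i\mathsf{SNR}_{i.1\to i}+\sum_{i.j\in\varUpsilon_i\setminus\{i.1\}}\mathsf{SNR}_{i.j\to i}+(1-\mu_{i'})\mathsf{INR}_{i'.1\to i}}{1+\mu_{i'}\mathsf{INR}_{i'.1\to i}}\right),$$ $$G_{\varOmega_i}=\mathsf{C}\left(\frac{\sum_{i.j\in\varOmega_i}\mathsf{SNR}_{i.j\to i}+(1-\mu_{i'})\mathsf{INR}_{i'.1\to i}}{1+\mu_{i'}\mathsf{INR}_{i'.1\to i}}\right).$$ **The region $\mathcal{R}_{\mathrm{o}}^{\mathrm{G}}=\mathcal{R}_{\mathrm{c}}(\overline A,\overline B,\overline E,\overline G)$.** $$\overline A_{\varUpsilon_i}=\mathsf{C}\left(\sum_{i.j\in\varUpsilon_i\setminus\{i.1\}}\mathsf{SNR}_{i.j\to i}+\frac{\mathsf{SNR}_{i.1\to i}}{1+\mathsf{INR}_{i.1\to i'}}\right),\qquad \overline B_{\varOmega_i}=\mathsf{C}\left(\sum_{i.j\in\varOmega_i}\mathsf{SNR}_{i.j\to i}\right),$$ $$\overline E_{\varUpsilon_i}=\mathsf{C}\left(\sum_{i.j\in\varUpsilon_i\setminus\{i.1\}}\mathsf{SNR}_{i.j\to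 i}+\frac{\mathsf{SNR}_{i.1\to i}}{1+\mathsf{INR}_{i.1\to i'}}+\mathsf{INR}_{i'.1\to i}\right),\qquad \overline G_{\varOmega_i}=\mathsf{C}\left(\sum_{i.j\in\varOmega_i}\mathsf{SNR}_{i.j\to i}+\mathsf{INR}_{i'.1\to i}\right).$$ *)

(* Defs.v *)
From mathcomp Require Import all_boot all_order all_algebra.
From mathcomp Require Import complex reals exp.

Set Implicit Arguments.
Unset Strict Implicit.
Unset Printing Implicit Defensive.

Import Order.TTheory GRing.Theory Num.Theory.
Import ComplexField.

Local Open Scope ring_scope.

Inductive cell := cell1 | cell2.

Definition other (i : cell) : cell :=
  match i with cell1 => cell2 | cell2 => cell1 end.

(* The Gaussian MAC-IC-MAC with outputs
     Y_i = \sum_j h_{i.j -> i} X_{i.j} + h_{i'.1 -> i} X_{i'.1} + Z_i,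
   where Z_i ~ CN(0, 1), i' = other i and E|X_{i.j}|^2 <= P_{i.j}.
   Only transmitter i.1 is heard in the other cell, so cross gains are indexed
   by the cell of the transmitter: [cross_gain i] is h_{i.1 -> i'}. *)
Record mac_ic_mac (R : realType) := MacIcMac {
  ntx : cell -> nat;
  ntx_gt0 : forall i, (0 < ntx i)%N;
  power : forall i, 'I_(ntx i) -> R;
  power_ge0 : forall i (j : 'I_(ntx i)), 0 <= power j;
  direct_gain : forall i, 'I_(ntx i) -> R[i];
  cross_gain : cell -> R[i]
}.

Arguments power {R} m i j.
Arguments direct_gain {R} m i j.

(* Transmitters are numbered from 0: [tx1 ch i] is i.1. *)
Definition tx1 (R : realType) (ch : mac_ic_mac R) (i : cell) : 'I_(ntx ch i) :=
  Ordinal (ntx_gt0 ch i).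

Definition snr (R : realType) (ch : mac_ic_mac R) (i : cell)
    (j : 'I_(ntx ch i)) : R :=
  power ch i j * Normc.normc (direct_gain ch i j) ^+ 2.

(* INR_{i.1 -> i'}: the interference caused by cell i. The interference
   received in cell i, INR_{i'.1 -> i}, is therefore [inr_from ch (other i)]. *)
Definition inr_from (R : realType) (ch : mac_ic_mac R) (i : cell) : R :=
  power ch i (tx1 ch i) * Normc.normc (cross_gain ch i) ^+ 2.

Definition rates (R : realType) (ch : mac_ic_mac R) :=
  forall i : cell, 'I_(ntx ch i) -> R.

Definition rate_sum (R : realType) (ch : mac_ic_mac R) (r : rates ch)
    (i : cell) (S : {set 'I_(ntx ch i)}) : R :=
  \sum_(j in S) r i j.

Definition set_fun (R : realType) (ch : mac_ic_mac R) :=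
  forall i : cell, {set 'I_(ntx ch i)} -> R.

(* Membership in R_c(A, B, E, G). U1, U2 range over the sets containing i.1,
   and W1, W2 over the non-empty sets. *)
Definition region (R : realType) (ch : mac_ic_mac R) (A B E G : set_fun ch)
    (r : rates ch) : Prop :=
  (forall i j, 0 <= r i j) /\
  forall (U1 W1 : {set 'I_(ntx ch cell1)}) (U2 W2 : {set 'I_(ntx ch cell2)}),
    tx1 ch cell1 \in U1 -> W1 != set0 ->
    tx1 ch cell2 \in U2 -> W2 != set0 ->
    rate_sum r W1 <= B cell1 W1 /\
    rate_sum r W2 <= B cell2 W2 /\
    rate_sum r U1 + rate_sum r W2 <= A cell1 U1 + G cell2 W2 /\
    rate_sum r W1 + rate_sum r U2 <= G cell1 W1 + A cell2 U2 /\
    rate_sum r U1 + rate_sum r U2 <= E cell1 U1 + E cell2 U2 /\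
    rate_sum r U1 + rate_sum r W1 + rate_sum r U2
      <= A cell1 U1 + G cell1 W1 + E cell2 U2 /\
    rate_sum r U1 + rate_sum r U2 + rate_sum r W2
      <= E cell1 U1 + A cell2 U2 + G cell2 W2.

Definition capacity (R : realType) (p : R) : R := ln (1 + p) / ln 2.

(* min{1, 1/INR_{i.1 -> i'}} with the convention 1/0 = +oo; the test is needed
   because 0^-1 = 0 in a field. *)
Definition mu (R : realType) (ch : mac_ic_mac R) (i : cell) : R :=
  if inr_from ch i == 0 then 1 else Num.min 1 (inr_from ch i)^-1.

Section Bounds.
Variables (R : realType) (ch : mac_ic_mac R).

Definition snr_sum (i : cell) (S : {set 'I_(ntx ch i)}) : R :=
  \sum_(j in S) snr j.

Definition noise (i : cell) : R :=
  1 + mu ch (other i) * inr_from ch (other i).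

Definition inner_A : set_fun ch := fun i U =>
  capacity ((mu ch i * snr (tx1 ch i) + snr_sum (U :\ tx1 ch i)) / noise i).

Definition inner_B : set_fun ch := fun i W =>
  capacity (snr_sum W / noise i).

Definition inner_E : set_fun ch := fun i U =>
  capacity ((mu ch i * snr (tx1 ch i) + snr_sum (U :\ tx1 ch i)
             + (1 - mu ch (other i)) * inr_from ch (other i)) / noise i).

Definition inner_G : set_fun ch := fun i W =>
  capacity ((snr_sum W + (1 - mu ch (other i)) * inr_from ch (other i))
            / noise i).

Definition outer_A : set_fun ch := fun i U =>
  capacity (snr_sum (U :\ tx1 ch i)
            + snr (tx1 ch i) / (1 + inr_from ch i)).

Definition outer_B : set_fun ch := fun i W => capacity (snr_sum W).

Definition outer_E : set_fun ch := fun i U =>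
  capacity (snr_sum (U :\ tx1 ch i)
            + snr (tx1 ch i) / (1 + inr_from ch i)
            + inr_from ch (other i)).

Definition outer_G : set_fun ch := fun i W =>
  capacity (snr_sum W + inr_from ch (other i)).

Definition inner_region : rates ch -> Prop :=
  region inner_A inner_B inner_E inner_G.

Definition outer_region : rates ch -> Prop :=
  region outer_A outer_B outer_E outer_G.

End Bounds.

(* Main.v *)
Require Import Defs.
From mathcomp Require Import all_boot all_order all_algebra.
From mathcomp Require Import reals.
From mathcomp Require Import exp ring lra.

Import Order.TTheory GRing.Theory Num.Theory.

Local Open Scope ring_scope.

(** Every set occurring in the constraints is non-empty, so lowering each rate
    by 1 lowers each rate sum by at least 1, and each constraint has as many
    rate sums on the left as set functions on the right. It thus suffices that
    each outer set function exceeds the inner one by at most one bit. This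
    holds because treating the private part of the interference as noise only
    costs a factor [1 + mu_{i'} INR_{i'.1 -> i}] of at most 2. *)

Lemma rate_sum_sub1 (R : realType) (ch : mac_ic_mac R) (r : rates ch)
    (i : cell) (S : {set 'I_(ntx ch i)}) :
  S != set0 -> rate_sum (fun i j => r i j - 1) S <= rate_sum r S - 1.
Proof.
rewrite -card_gt0 => S_gt0.
by rewrite /rate_sum sumrB lerD2l lerN2 sumr_const ler1n.
Qed.

Lemma region_sub1 (R : realType) (ch : mac_ic_mac R)
    (A B E G A' B' E' G' : set_fun ch) (r : rates ch) :
  (forall i S, A' i S <= A i S + 1) -> (forall i S, B' i S <= B i S + 1) ->
  (forall i S, E' i S <= E i S + 1) -> (forall i S, G' i S <= G i S + 1) ->
  (forall i j, 1 <= r i j) -> region A' B' E' G' r ->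
  region A B E G (fun i j => r i j - 1).
Proof.
move=> leA leB leE leG r_ge1 [_ rP]; split=> [i j|]; first by rewrite subr_ge0.
move=> U1 W1 U2 W2 U1x W1n0 U2x W2n0.
have [b1 [b2 [ag [ga [ee [age eag]]]]]] := rP _ _ _ _ U1x W1n0 U2x W2n0.
have U1n0 : U1 != set0 by apply/set0Pn; exists (tx1 ch cell1).
have U2n0 : U2 != set0 by apply/set0Pn; exists (tx1 ch cell2).
have := rate_sum_sub1 _ _ r _ _ U1n0; have := rate_sum_sub1 _ _ r _ _ U2n0.
have := rate_sum_sub1 _ _ r _ _ W1n0; have := rate_sum_sub1 _ _ r _ _ W2n0.
have := leA _ U1; have := leA _ U2; have := leE _ U1; have := leE _ U2.
have := leB _ W1; have := leB _ W2; have := leG _ W1; have := leG _ W2.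
by do !split; lra.
Qed.

(** One extra bit doubles the argument of the logarithm, so the claim amounts to
    [1 + x <= 2 * (1 + y / n)], here with the denominator cleared. *)
Lemma capacity_gap (R : realType) (n x y : R) :
  0 < n -> 0 <= x -> n * (1 + x) <= 2 * (n + y) ->
  capacity x <= capacity (y / n) + 1.
Proof.
move=> n0 x0 le_xy; rewrite /capacity.
have ln2_gt0 : 0 < ln 2 :> R by apply: ln_gt0; lra.
have le2 : 1 + x <= (1 + y / n) * 2.
  rewrite -(ler_pM2l n0) (le_trans le_xy)// le_eqVlt; apply/orP; left.
  by apply/eqP; field; rewrite gt_eqF.
(* The sign of this logarithm argument is read off from [le2] and [0 <= x]. *)
have y0 : 0 < 1 + y / n by lra.
rewrite ler_pdivrMr// mulrDl divfK ?gt_eqF// mul1r -lnM ?posrE//.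
by rewrite ler_ln ?posrE//; lra.
Qed.

Section Gap.
Variables (R : realType) (ch : mac_ic_mac R).

Lemma snr_ge0 (i : cell) (j : 'I_(ntx ch i)) : 0 <= snr j.
Proof. by rewrite mulr_ge0 ?power_ge0 ?sqr_ge0. Qed.

Lemma inr_from_ge0 (i : cell) : 0 <= inr_from ch i.
Proof. by rewrite mulr_ge0 ?power_ge0 ?sqr_ge0. Qed.

Lemma snr_sum_ge0 (i : cell) (S : {set 'I_(ntx ch i)}) : 0 <= snr_sum S.
Proof. by apply: sumr_ge0 => j _; apply: snr_ge0. Qed.

(** The private signal of transmitter i.1 reaches the other receiver at or below the unit noise
    level; both bounds on [noise] come from this. *)
Lemma mu_inr_from (i : cell) :
  mu ch i * inr_from ch i = Num.min (inr_from ch i) 1.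
Proof.
rewrite /mu; have I0 := inr_from_ge0 i; case: eqP => [->|/eqP In0].
  by rewrite mulr0 min_l.
by rewrite minr_pMl// mul1r mulVf.
Qed.

(** Both 1 and, for nonzero INR, 1/INR are at least 1/(1+INR). Hence the private SNR in the inner
    functions dominates the one in the outer functions. *)
Lemma mu_ge (i : cell) : (1 + inr_from ch i)^-1 <= mu ch i.
Proof.
rewrite /mu; have I0 := inr_from_ge0 i.
have le1 : (1 + inr_from ch i)^-1 <= 1 by rewrite invf_le1; lra.
case: eqP => [//|/eqP In0]; rewrite le_min le1 /=.
have Igt0 : 0 < inr_from ch i by rewrite lt0r In0.
by rewrite lef_pV2 ?posrE; lra.
Qed.

Lemma noise_ge1 (i : cell) : 1 <= noise ch i.
Proof. by rewrite lerDl mu_inr_from le_min inr_from_ge0 ler01. Qed.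

Lemma noise_le2 (i : cell) : noise ch i <= 2.
Proof. by rewrite lerD2l mu_inr_from ge_min lexx orbT. Qed.

Lemma snr_private (i : cell) :
  0 <= snr (tx1 ch i) / (1 + inr_from ch i) <= mu ch i * snr (tx1 ch i).
Proof.
rewrite [X in _ <= _ <= X]mulrC ler_wpM2l ?snr_ge0 ?mu_ge// andbT.
by rewrite divr_ge0 ?snr_ge0 ?addr_ge0 ?inr_from_ge0.
Qed.

(* With [c = 0] for the functions that ignore the interference, and
   [c = INR_{i'.1 -> i}] for the others. *)
Lemma noise_gap (i : cell) (p q c d : R) :
  0 <= p <= q -> 0 <= c -> 1 + c <= noise ch i + d ->
  capacity (p + c) <= capacity ((q + d) / noise ch i) + 1.
Proof.
move=> /andP[p0 pq] c0 le_cd; have n1 := noise_ge1 i; have n2 := noise_le2 i.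
apply: capacity_gap; [lra|lra|].
(* The factor 2 is spent on the noise; then [1 + c <= noise ch i + d] and [p <= q] bound what
   remains. *)
have : noise ch i * (1 + (p + c)) <= 2 * (1 + (p + c)).
  by rewrite ler_wpM2r//; lra.
by lra.
Qed.

Lemma noise_gap0 (i : cell) (p q : R) : 0 <= p <= q ->
  capacity p <= capacity (q / noise ch i) + 1.
Proof.
move=> pq; rewrite -[p]addr0 -[q]addr0; apply: noise_gap => //.
by rewrite !addr0 noise_ge1.
Qed.

(** Noise, private and common interference add up to 1 + INR, so the last hypothesis of [noise_gap]
    holds with equality. *)
Lemma noise_gap_inr (i : cell) (p q : R) : 0 <= p <= q ->
  capacity (p + inr_from ch (other i)) <=
  capacity ((q + (1 - mu ch (other i)) * inr_from ch (other i)) / noise ch i)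
    + 1.
Proof.
move=> pq; apply: noise_gap => //; first exact: inr_from_ge0.
by rewrite /noise; lra.
Qed.

Lemma snr_sum_private (i : cell) (U : {set 'I_(ntx ch i)}) :
  0 <= snr_sum (U :\ tx1 ch i) + snr (tx1 ch i) / (1 + inr_from ch i)
    <= mu ch i * snr (tx1 ch i) + snr_sum (U :\ tx1 ch i).
Proof.
have := snr_sum_ge0 _ (U :\ tx1 ch i); have /andP[] := snr_private i.
by move=> *; apply/andP; split; lra.
Qed.

End Gap.

Theorem lemma3 (R : realType) (ch : mac_ic_mac R) (r : rates ch)
    (r_outer : outer_region r) (r_ge1 : forall i j, 1 <= r i j) :
  inner_region (fun i j => r i j - 1).
Proof.
apply: region_sub1 r_ge1 r_outer => i S.
- exact/noise_gap0/snr_sum_private.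
- by apply: noise_gap0; rewrite snr_sum_ge0 lexx.
- exact/noise_gap_inr/snr_sum_private.
- by apply: noise_gap_inr; rewrite snr_sum_ge0 lexx.
Qed.
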